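(* Let $Z=C[0,1]$ be the space of continuous scalar-valued functions on $[0,1]$ equipped with the $L_1$-norm $\|f\|_1=\int_0^1|f(t)|\,dt$, and let $Z_1=\{f\in Z:\|f\|_1\le 1\}$. Then $Z$ is not weakly facially symmetric. More precisely, the set $$F=\left\{f\in Z_1:\int_0^{1/2}f(t)\,dt=1\right\}$$ is a norm-exposed face of $Z_1$ that is not symmetric.
   Context: Let $X$ be a real or complex normed space (not assumed complete) with closed unit ball $X_1$ and dual $X^*$. Orthogonality: $f,g\in X$ are orthogonal, $f\diamond g$, if $\|f+g\|=\|f-g\|=\|f\|+\|g\|$. For $S\subset X$, $S^\diamond=\{f\in X: f\diamond g \text{ for every } g\in S\}$. A norm-exposed face of $X_1$ is a nonempty set of the form $F_u=\{f\in X_1: u(f)=1\}$ with $u\in X^*$, $\|u\|=1$. A norm-exposed face $F$ is symmetric (in the sense of Friedman and Russo) if there is a surjective linear isometry $S_F:X\to X$ with $S_F^2=I$ and $\operatorname{Fix}(S_F)=\{x: S_Fx=x\}=\overline{\operatorname{sp}(F)}\oplus F^\diamond$, where $\overline{\operatorname{sp}(F)}$ is the norm-closed linear span of $F$ in $X$. $X$ is weakly facially symmetric if every norm-exposed face of $X_1$ is symmetric. *)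

(* Defs.v *)
From HB Require Import structures.
From mathcomp Require Import all_boot all_order all_algebra.
From mathcomp Require Import all_classical all_reals all_analysis.
From mathcomp Require Import complex lra.

Set Implicit Arguments.
Unset Strict Implicit.
Unset Printing Implicit Defensive.

Import Order.TTheory GRing.Theory Num.Theory.
Import numFieldNormedType.Exports.

Local Open Scope classical_set_scope.
Local Open Scope ring_scope.

Section FacialSymmetry.
Variables (K : numFieldType) (X : normedModType K).
Implicit Types (f g : X) (u : {linear X -> K^o}) (A B C F S : set X).

Definition orthogonal f g : Prop :=
  `|f + g| = `|f| + `|g| /\ `|f - g| = `|f| + `|g|.

Definition orthocompl S : set X := [set f | forall g, S g -> orthogonal f g].

Definition unit_ball : set X := [set f | `|f| <= 1].

(* c = ||u||, the supremum of |u f| over the unit ball. When K is the complex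
   field its order is partial (z <= w iff w - z is a nonnegative real); a
   nonempty set of reals has the same least upper bound for it as in the real
   numbers. *)
Definition has_dual_norm u (c : K) : Prop :=
  supremums [set `|u f| | f in unit_ball] c.

Definition face u : set X := [set f | unit_ball f /\ u f = 1].

Definition norm_exposed_face F : Prop :=
  F !=set0 /\
  exists u, [/\ continuous u, has_dual_norm u 1 & F = face u].

Definition linear_span S : set X :=
  [set x | exists (n : nat) (a : 'I_n -> K) (s : 'I_n -> X),
     (forall i, S (s i)) /\ x = \sum_(i < n) a i *: s i].

(* C = A (+) B. An orthogonal complement need not be a linear subspace, so
   directness is stated as uniqueness of the decomposition. *)
Definition is_direct_sum A B C : Prop :=
  C = [set a + b | a in A & b in B] /\
  (forall a a' b b', A a -> A a' -> B b -> B b' ->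
     a + b = a' + b' -> a = a' /\ b = b').

Definition symmetric_face F : Prop :=
  exists T : {linear X -> X},
    [/\ forall x, `|T x| = `|x|,
        forall y, exists x, T x = y,
        forall x, T (T x) = x
      & is_direct_sum (closure (linear_span F)) (orthocompl F)
                      [set x | T x = x]].

End FacialSymmetry.

Definition weakly_facially_symmetric (K : numFieldType) (X : normedModType K) :=
  forall F : set X, norm_exposed_face F -> symmetric_face F.

Inductive scalar_kind := RealScalars | ComplexScalars.

Definition scalars (R : realType) (k : scalar_kind) : numFieldType :=
  match k with RealScalars => R | ComplexScalars => R[i] end.

Definition scalar_integral (R : realType) (k : scalar_kind) (a b : R) :
    (R -> scalars R k) -> scalars R k :=
  match k return (R -> scalars R k) -> scalars R k with
  | RealScalars => fun f : R -> R =>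
      (\int[lebesgue_measure]_(t in `[a, b]) f t)%R
  | ComplexScalars => fun f : R -> R[i] =>
      Complex (\int[lebesgue_measure]_(t in `[a, b]) complex.Re (f t))%R
              (\int[lebesgue_measure]_(t in `[a, b]) complex.Im (f t))%R
  end.

Section RealScalarEmbedding.
Variables (R : realType) (k : scalar_kind).
Local Notation K := (scalars R k).
Local Notation mu := lebesgue_measure.

Definition of_real : R -> K :=
  match k return R -> scalars R k with
  | RealScalars => fun x : R => x
  | ComplexScalars => fun x : R => Complex x 0
  end.

Definition real_norm : K -> R :=
  match k return scalars R k -> R with
  | RealScalars => fun x : R => `|x|
  | ComplexScalars => fun z : R[i] => Normc.normc z
  end.

Lemma normE (z : K) : `|z| = of_real (real_norm z).
Proof. by rewrite /of_real /real_norm; case: k z. Qed.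

Lemma ler_of_real x y : (of_real x <= of_real y) = (x <= y).
Proof. by rewrite /of_real; case: k => //; rewrite lecR. Qed.

Lemma of_realD x y : of_real (x + y) = of_real x + of_real y.
Proof. by rewrite /of_real; case: k => //; apply/eqP; rewrite eq_complex /= addr0 !eqxx. Qed.

Lemma of_realM x y : of_real (x * y) = of_real x * of_real y.
Proof. by rewrite /of_real; case: k => //; apply/eqP; rewrite eq_complex /= !mulr0 mul0r subr0 addr0 !eqxx. Qed.

Lemma of_real0 : of_real 0 = 0.
Proof. by rewrite /of_real; case: k. Qed.

Lemma of_real_inj : injective of_real.
Proof. by move=> x y xy; apply/le_anti; rewrite -!ler_of_real xy lexx. Qed.

Lemma real_norm_ge0 z : 0 <= real_norm z.
Proof. by rewrite -ler_of_real -normE of_real0. Qed.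

Lemma real_norm_eq0 z : real_norm z = 0 -> z = 0.
Proof. by move=> z0; apply/eqP; rewrite -normr_eq0 normE z0 of_real0. Qed.

Lemma ler_real_normD x y : real_norm (x + y) <= real_norm x + real_norm y.
Proof. by rewrite -ler_of_real of_realD -!normE ler_normD. Qed.

Lemma real_normM x y : real_norm (x * y) = real_norm x * real_norm y.
Proof. by apply: of_real_inj; rewrite of_realM -!normE normrM. Qed.

Lemma real_normB x y : real_norm (x - y) = real_norm (y - x).
Proof. by apply: of_real_inj; rewrite -!normE distrC. Qed.

Lemma ler_real_norm_dist x y :
  `|real_norm x - real_norm y| <= real_norm (x - y).
Proof.
have H z w : real_norm z - real_norm w <= real_norm (z - w).
  by rewrite lerBlDr (le_trans _ (ler_real_normD _ _))// subrK.
by rewrite ler_norml H andbT lerNl opprB real_normB H.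
Qed.

Lemma continuous_real_norm : continuous (real_norm : K^o -> R).
Proof.
move=> z; apply/(@cvgrPdist_lt _ _ _ (nbhs z) (@nbhs_filter K^o z)) => /= e e0.
have lt_of_real x y : (of_real x < of_real y) = (x < y).
  by rewrite !lt_neqAle ler_of_real (inj_eq of_real_inj).
have e0' : 0 < of_real e by rewrite -of_real0 lt_of_real.
apply/nbhs_normP; exists (of_real e) => //= w zw.
by rewrite (le_lt_trans (ler_real_norm_dist _ _))// -lt_of_real -normE.
Qed.

Lemma scalar_integral_of_real (a b : R) (h : R -> R) :
  scalar_integral a b (fun t => of_real (h t)) =
  of_real (\int[mu]_(t in `[a, b]) h t)%R.
Proof.
rewrite /scalar_integral /of_real; case: k => //=; congr Complex.
by rewrite Rintegral_cst// mul0r.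
Qed.

End RealScalarEmbedding.

Section Continuity.
Variables (T : topologicalType) (K : numFieldType) (V : normedModType K).
Implicit Types f g : T -> V.

Lemma continuousD_fun f g :
  continuous f -> continuous g -> continuous (fun x => f x + g x).
Proof. by move=> cf cg x; apply: cvgD; [exact: cf|exact: cg]. Qed.

Lemma continuousN_fun f : continuous f -> continuous (fun x => - f x).
Proof. by move=> cf x; apply: cvgN; exact: cf. Qed.

Lemma continuousZ_fun (c : K) f : continuous f -> continuous (fun x => c *: f x).
Proof. by move=> cf x; apply: cvgZr; exact: cf. Qed.

End Continuity.

Lemma continuous_comp_fun (T U V : topologicalType) (f : T -> U) (g : U -> V) :
  continuous f -> continuous g -> continuous (g \o f).
Proof. by move=> cf cg x; apply: continuous_comp; [exact: cf|exact: cg]. Qed.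

Lemma Rintegral_eq0 (R : realType) (g : R -> R) :
  {within `[0, 1], continuous g} -> (forall t, 0 <= g t) ->
  (\int[lebesgue_measure]_(t in `[0, 1]) g t)%R = 0 ->
  forall t, `[0, 1]%classic t -> g t = 0.
Proof.
move=> cg g0 ig0 x x01; apply/eqP; apply: contraT => gx.
have gxp : 0 < g x by rewrite lt_neqAle eq_sym gx g0.
have intg : lebesgue_measure.-integrable `[0%R, 1%R] (EFin \o g).
  by apply: continuous_compact_integrable => //; exact: segment_compact.
have iabs0 : (\int[lebesgue_measure]_(t in `[0%R, 1%R]) `|(EFin \o g) t| = 0)%E.
  under eq_integral => t _ do rewrite /= ger0_norm//.
  by rewrite -(fineK (integrable_fin_num _ intg))//; congr (_%:E).
have mg := measurable_int _ intg.
have [N [mN N0 sN]] :=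
  (ae_eq_integral_abs lebesgue_measure (measurable_itv _) mg).1 iabs0.
have /subspace_continuousP/(_ x x01)/cvgrPdist_lt/(_ _ gxp) := cg.
rewrite near_withinE => /nbhs_ballP[e /= e0 He].
set a := Num.max 0 (x - e); set b := Num.min 1 (x + e).
have ab : a < b.
  move: x01; rewrite /= in_itv/= => /andP[x0 x1].
  rewrite /a /b lt_min !gt_max; lra.
have gJ t : `]a, b[%classic t -> `[0, 1]%classic t /\ g t != 0.
  rewrite /= !in_itv/= /a /b lt_min !gt_max => /andP[/andP[t0 t1] /andP[t2 t3]].
  have t01 : `[0, 1]%classic t by rewrite /= in_itv/= !ltW.
  split=> //; have /= := He t; rewrite /ball/=.
  have xte : `|x - t| < e by rewrite ltr_norml; lra.
  move=> /(_ xte t01) h; apply/eqP => gt0; move: h.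
  by rewrite /from_subspace gt0 subr0 ger0_norm// ltxx.
have : (lebesgue_measure `]a, b[ <= lebesgue_measure N)%E.
  apply: le_measure; rewrite ?inE//.
  move=> t /gJ[t01 gt]; apply: sN => /= /(_ t01) [] /eqP; exact/negP.
rewrite N0 lebesgue_measure_itv /= lte_fin ab -EFinB lee_fin subr_le0.
by move=> /(lt_le_trans ab); rewrite ltxx.
Qed.

(* The set [0,1], coerced to a type, carries the topology induced from R. *)
Definition C01 (R : realType) (k : scalar_kind) : Type :=
  continuousType (`[0, 1]%classic : set R) (scalars R k)^o.

Section C01Module.
Variables (R : realType) (k : scalar_kind).
Local Notation K := (scalars R k).
Local Notation I01 := (`[0, 1]%classic : set R).
Local Notation C := (C01 R k).
Local Notation mu := lebesgue_measure.

HB.instance Definition _ := Choice.copy C (continuousType I01 K^o).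

Definition C01_fun (f : C) : I01 -> K^o := f.

Lemma C01_funP (f g : C) : C01_fun f =1 C01_fun g -> f = g.
Proof. by move=> fg; exact: (proj2 (@continuousEP I01 K^o f g) fg). Qed.

Lemma C01_cts (f : C) : continuous (C01_fun f).
Proof. exact: (@cts_fun _ _ (f : continuousType I01 K^o)). Qed.

Definition mkC01 (f : I01 -> K^o) (cf : continuous f) : C := mkcts cf.

Lemma C01_cst_cts (c : K^o) : continuous (fun _ : I01 => c).
Proof. exact: cst_continuous. Qed.

Lemma C01_add_cts (f g : C) : continuous (fun x => C01_fun f x + C01_fun g x).
Proof. by apply: continuousD_fun; exact: C01_cts. Qed.

Lemma C01_opp_cts (f : C) : continuous (fun x => - C01_fun f x).
Proof. by apply: continuousN_fun; exact: C01_cts. Qed.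

Lemma C01_scale_cts (c : K) (f : C) : continuous (fun x => c *: C01_fun f x).
Proof. by apply: continuousZ_fun; exact: C01_cts. Qed.

Definition C01_zero : C := mkC01 (@C01_cst_cts 0).
Definition C01_opp f : C := mkC01 (@C01_opp_cts f).
Definition C01_add f g : C := mkC01 (@C01_add_cts f g).
Definition C01_scale c f : C := mkC01 (@C01_scale_cts c f).

Lemma C01_addA : associative C01_add.
Proof. by move=> f g h; apply: C01_funP => x; exact: addrA. Qed.

Lemma C01_addC : commutative C01_add.
Proof. by move=> f g; apply: C01_funP => x; exact: addrC. Qed.

Lemma C01_add0 : left_id C01_zero C01_add.
Proof. by move=> f; apply: C01_funP => x; exact: add0r. Qed.

Lemma C01_addN : left_inverse C01_zero C01_opp C01_add.
Proof. by move=> f; apply: C01_funP => x; exact: addNr. Qed.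

HB.instance Definition _ :=
  GRing.isZmodule.Build C C01_addA C01_addC C01_add0 C01_addN.

Lemma C01_scaleA a b f : C01_scale a (C01_scale b f) = C01_scale (a * b) f.
Proof. by apply: C01_funP => x; exact: scalerA. Qed.

Lemma C01_scale1 : left_id 1 C01_scale.
Proof. by move=> f; apply: C01_funP => x; exact: scale1r. Qed.

Lemma C01_scaleDr : right_distributive C01_scale +%R.
Proof. by move=> a f g; apply: C01_funP => x; exact: scalerDr. Qed.

Lemma C01_scaleDl f : {morph C01_scale^~ f : a b / a + b}.
Proof. by move=> a b; apply: C01_funP => x; exact: scalerDl. Qed.

HB.instance Definition _ := GRing.Zmodule_isLmodule.Build K C
  C01_scaleA C01_scale1 C01_scaleDr C01_scaleDl.

Lemma C01_addE f g x : C01_fun (f + g) x = C01_fun f x + C01_fun g x.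
Proof. by []. Qed.

Lemma C01_scaleE c f x : C01_fun (c *: f) x = c * C01_fun f x.
Proof. by []. Qed.

(* f extended by 0 outside [0,1], so that it can be integrated over subsets
   of R *)
Definition C01_ext (f : C) : R -> K := 'valL_ 0 (C01_fun f).

Definition C01_norm (f : C) : K := scalar_integral 0 1 (fun t => `|C01_ext f t|).

Lemma C01_extE (f : C) (x : I01) : C01_ext f (val x) = C01_fun f x.
Proof. by rewrite -[LHS]/(sigL I01 (C01_ext f) x) /C01_ext valLK. Qed.

Lemma C01_ext_in (f : C) t (t01 : t \in I01) :
  C01_ext f t = C01_fun f (SigSub t01).
Proof. by rewrite -C01_extE. Qed.

Lemma continuous_real_norm_ext (f : C) :
  {within `[0, 1], continuous (fun t => real_norm (C01_ext f t))}.
Proof.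
apply/subspace_sigL_continuousP.
have -> : sigL I01 (fun t => real_norm (C01_ext f t)) =
          @real_norm R k \o C01_fun f.
  by apply/funext => x /=; rewrite -C01_extE.
apply: continuous_comp_fun.
- exact: C01_cts.
- exact: continuous_real_norm.
Qed.

Lemma integrable_real_norm_ext (f : C) :
  mu.-integrable `[0, 1] (EFin \o (fun t => real_norm (C01_ext f t))).
Proof.
apply: continuous_compact_integrable; first exact: segment_compact.
exact: continuous_real_norm_ext.
Qed.

Lemma C01_normE f :
  C01_norm f = of_real k (\int[mu]_(t in `[0, 1]) real_norm (C01_ext f t))%R.
Proof.
rewrite -scalar_integral_of_real; congr (scalar_integral _ _).
by apply/funext => t; rewrite normE.
Qed.

Lemma C01_ler_normD f g : C01_norm (f + g) <= C01_norm f + C01_norm g.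
Proof.
rewrite !C01_normE -of_realD ler_of_real -RintegralD//;
  try exact: integrable_real_norm_ext.
apply: le_Rintegral => //; first exact: integrable_real_norm_ext.
  exact: (@integrableD _ _ _ mu _ _ _ _
    (integrable_real_norm_ext f) (integrable_real_norm_ext g)).
move=> t /mem_set t01; rewrite !(C01_ext_in _ t01) C01_addE.
exact: ler_real_normD.
Qed.

Lemma C01_normZ (c : K) f : C01_norm (c *: f) = `|c| * C01_norm f.
Proof.
rewrite !C01_normE normE -of_realM -RintegralZl//;
  last exact: integrable_real_norm_ext.
congr of_real; apply: eq_Rintegral => t t01.
by rewrite !(C01_ext_in _ t01) C01_scaleE real_normM.
Qed.

Lemma C01_norm_eq0 f : C01_norm f = 0 -> f = 0.
Proof.
rewrite C01_normE -(of_real0 R k) => /of_real_inj f0.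
apply: C01_funP => x; rewrite -C01_extE; apply: real_norm_eq0.
apply: (Rintegral_eq0 _ _ f0).
- exact: continuous_real_norm_ext.
- by move=> t; exact: real_norm_ge0.
- exact: set_mem (valP x).
Qed.

HB.instance Definition _ :=
  Lmodule_isNormed.Build K C C01_ler_normD C01_normZ C01_norm_eq0.

Lemma C01_norm_def (f : C) :
  `|f| = scalar_integral 0 1 (fun t => `|C01_ext f t|).
Proof. by []. Qed.

End C01Module.

(* Main.v *)
(* The functional f |-> \int_0^(1/2) f exposes F, whose elements vanish on
   [1/2,1]. Hence every element of the closed span of F vanishes on [1/2,1],
   and, testing against one element of F positive on [0,1/2), every element of
   the orthocomplement of F vanishes on [0,1/2]. The sum of the two only
   contains functions vanishing at 1/2, but it is dense: the constant 1 is an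
   L_1-limit of sums of two ramps, one on each side of 1/2. An isometry fixing
   the sum therefore fixes 1, which is not in the sum. *)

From HB Require Import structures.
Require Import Defs.
From mathcomp Require Import all_boot all_order all_algebra.
From mathcomp Require Import all_classical all_reals all_analysis.
From mathcomp Require Import complex lra.

Import Order.TTheory GRing.Theory Num.Theory.
Import numFieldNormedType.Exports.

Local Open Scope classical_set_scope.
Local Open Scope ring_scope.

(** * Componentwise arithmetic common to real and complex scalars *)

Section Scalars.
Set Implicit Arguments.
Unset Strict Implicit.
Variables (R : realType) (k : scalar_kind).
Local Notation K := (scalars R k).

Definition re : K -> R :=
  match k return scalars R k -> R with
  | RealScalars => fun x : R => x
  | ComplexScalars => fun z : R[i] => complex.Re z
  end.

(** The value 0 for real scalars makes the complex sum and product formulas valid for both kinds of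
    scalars, so later arguments need no case split. *)
Definition im : K -> R :=
  match k return scalars R k -> R with
  | RealScalars => fun=> 0
  | ComplexScalars => fun z : R[i] => complex.Im z
  end.

Lemma scalar_ext (z w : K) : re z = re w -> im z = im w -> z = w.
Proof.
rewrite /re /im; case: k z w => //= -[a b] [c d] /= -> -> //.
Qed.

Lemma reD (z w : K) : re (z + w) = re z + re w.
Proof. by rewrite /re; case: k z w => //= -[a b] [c d]. Qed.

Lemma imD (z w : K) : im (z + w) = im z + im w.
Proof. by rewrite /im; case: k z w => /= [? ?|[a b] [c d]//]; rewrite addr0. Qed.

Lemma reN (z : K) : re (- z) = - re z.
Proof. by rewrite /re; case: k z => //= -[a b]. Qed.

Lemma imN (z : K) : im (- z) = - im z.
Proof. by rewrite /im; case: k z => /= [?|[a b]//]; rewrite oppr0. Qed.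

Lemma reM (z w : K) : re (z * w) = re z * re w - im z * im w.
Proof.
by rewrite /re /im; case: k z w => /= [? ?|[a b] [c d]//]; rewrite mulr0 subr0.
Qed.

Lemma imM (z w : K) : im (z * w) = re z * im w + im z * re w.
Proof.
rewrite /re /im; case: k z w => /= [? ?|[a b] [c d]//].
by rewrite mulr0 mul0r addr0.
Qed.

Lemma re_of_real (x : R) : re (of_real k x) = x.
Proof. by rewrite /re /of_real; case: k. Qed.

Lemma im_of_real (x : R) : im (of_real k x) = 0.
Proof. by rewrite /im /of_real; case: k. Qed.

Lemma re_scalar_integral a b (f : R -> K) :
  re (scalar_integral a b f) = (\int[lebesgue_measure]_(t in `[a, b]) re (f t))%R.
Proof. by rewrite /re /scalar_integral; case: k f. Qed.

Lemma im_scalar_integral a b (f : R -> K) :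
  im (scalar_integral a b f) = (\int[lebesgue_measure]_(t in `[a, b]) im (f t))%R.
Proof.
by rewrite /im /scalar_integral; case: k f => //= f; rewrite Rintegral_cst// mul0r.
Qed.

Lemma of_real1 : of_real k 1 = 1 :> K.
Proof. by apply: scalar_ext; rewrite /of_real /re /im; case: k. Qed.

Lemma real_norm_of_real (x : R) : real_norm (of_real k x) = `|x|.
Proof.
rewrite /real_norm /of_real; case: k => //=.
by rewrite expr0n/= addr0 sqrtr_sqr.
Qed.

Lemma real_norm0 : real_norm (0 : K) = 0.
Proof. by rewrite -of_real0 real_norm_of_real normr0. Qed.

Lemma real_normN (z : K) : real_norm (- z) = real_norm z.
Proof. by apply: (@of_real_inj R k); rewrite -!normE normrN. Qed.

Lemma of_realN (x : R) : of_real k (- x) = - of_real k x.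
Proof. by apply/eqP; rewrite -addr_eq0 -of_realD addNr of_real0. Qed.

Lemma of_realV (x : R) : of_real k x^-1 = (of_real k x)^-1.
Proof.
have [->|x0] := eqVneq x 0; first by rewrite invr0 of_real0 invr0.
have nz : of_real k x != 0 by rewrite -(of_real0 R k) (inj_eq (@of_real_inj _ _)).
by apply: (mulIf nz); rewrite -of_realM !mulVf// of_real1.
Qed.

Lemma normr_re_le (z : K) : `|re z| <= real_norm z.
Proof.
rewrite /re /real_norm; case: k z => //= -[a b] /=.
by rewrite -sqrtr_sqr ler_wsqrtr// lerDl sqr_ge0.
Qed.

Lemma normr_im_le (z : K) : `|im z| <= real_norm z.
Proof.
rewrite /im /real_norm; case: k z => /= [z|[a b]/=]; first by rewrite normr0.
by rewrite -sqrtr_sqr ler_wsqrtr// lerDr sqr_ge0.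
Qed.

Lemma real_norm_sqr (z : K) : real_norm z ^+ 2 = re z ^+ 2 + im z ^+ 2.
Proof.
rewrite /re /im /real_norm; case: k z => /= [z|[a b]/=].
  by rewrite expr0n addr0 real_normK// num_real.
by rewrite sqr_sqrtr// addr_ge0 ?sqr_ge0.
Qed.

(* Parallelogram law: |z + x|^2 + |z - x|^2 = 2 |z|^2 + 2 x^2. *)
Lemma real_norm_add_sub_eq0 (z : K) (x : R) : 0 < x ->
  real_norm (z + of_real k x) = real_norm z + x ->
  real_norm (z - of_real k x) = real_norm z + x -> z = 0.
Proof.
move=> x0 hD hB; apply: real_norm_eq0.
have := real_norm_sqr (z + of_real k x); have := real_norm_sqr (z - of_real k x).
rewrite hD hB -of_realN !reD !imD !re_of_real !im_of_real => e1 e2.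
have e := real_norm_sqr z.
have : real_norm z * x = 0 by nra.
by move/eqP; rewrite mulf_eq0 (gt_eqF x0) orbF => /eqP.
Qed.

Lemma ltr_of_real (x y : R) : (of_real k x < of_real k y) = (x < y).
Proof. by rewrite !lt_neqAle ler_of_real (inj_eq (@of_real_inj _ _)). Qed.

Lemma continuous_of_real : continuous (of_real k : R -> K^o).
Proof.
move=> x; apply/(@cvgrPdist_lt _ K^o _ (nbhs x) (nbhs_filter x)) => /= e e0.
have eE : e = of_real k (real_norm e) by rewrite -normE gtr0_norm.
have e0' : 0 < real_norm e.
  by rewrite -ltr_of_real -eE of_real0.
apply/nbhs_normP; exists (real_norm e) => //= y xy.
rewrite -of_realN -of_realD normE real_norm_of_real eE ltr_of_real; exact: xy.
Qed.

End Scalars.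

(** * A continuous cutoff profile on the line *)

Section Ramp.
Set Implicit Arguments.
Unset Strict Implicit.
Variable R : realType.

Definition ramp (x : R) : R := Num.min 1 (Num.max 0 x).

Lemma ramp_ge0 x : 0 <= ramp x.
Proof. by rewrite /ramp le_min ler01 le_max lexx. Qed.

Lemma ramp_le1 x : ramp x <= 1.
Proof. by rewrite /ramp ge_min lexx. Qed.

Lemma ramp_eq0 x : x <= 0 -> ramp x = 0.
Proof. by move=> x0; rewrite /ramp (max_idPl x0); apply/min_idPr. Qed.

Lemma ramp_eq1 x : 1 <= x -> ramp x = 1.
Proof.
by move=> x1; apply/min_idPl; rewrite le_max x1 orbT.
Qed.

Lemma ramp_gt0 x : 0 < x -> 0 < ramp x.
Proof. by move=> x0; rewrite /ramp lt_min ltr01 lt_max x0 orbT. Qed.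

Lemma continuous_ramp : continuous ramp.
Proof.
move=> x; apply: continuous_min; first exact: cst_continuous.
by apply: continuous_max; [exact: cst_continuous|exact: cvg_id].
Qed.

End Ramp.

(** * The L_1 norm and the integral over [0,1/2], reduced to real integrals *)

Section C01Facts.
Set Implicit Arguments.
Unset Strict Implicit.
Variables (R : realType) (k : scalar_kind).
Local Notation K := (scalars R k).
Local Notation C := (C01 R k).
Local Notation I01 := (`[0, 1]%classic : set R).
Local Notation mu := lebesgue_measure.

(** Thanks to this default value, the pointwise identities below hold at every real [t], without a
    membership hypothesis. *)
Lemma C01_ext_out (f : C) t : t \notin I01 -> C01_ext f t = 0.
Proof. by move=> t01; rewrite /C01_ext /valL_ /= oinv_set_val insubN. Qed.

Lemma C01_extD (f g : C) t : C01_ext (f + g) t = C01_ext f t + C01_ext g t.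
Proof.
have [t01|t01] := boolP (t \in I01); last by rewrite !C01_ext_out// addr0.
by rewrite !(C01_ext_in _ t01).
Qed.

Lemma C01_extZ (c : K) (f : C) t : C01_ext (c *: f) t = c * C01_ext f t.
Proof.
have [t01|t01] := boolP (t \in I01); last by rewrite !C01_ext_out// mulr0.
by rewrite !(C01_ext_in _ t01).
Qed.

Lemma C01_extN (f : C) t : C01_ext (- f) t = - C01_ext f t.
Proof. by rewrite -scaleN1r C01_extZ mulN1r. Qed.

Lemma C01_ext0 t : C01_ext (0 : C) t = 0.
Proof. by rewrite -(scale0r (0 : C)) C01_extZ mul0r. Qed.

Lemma C01_ext_inj (f g : C) : (forall t, C01_ext f t = C01_ext g t) -> f = g.
Proof. by move=> fg; apply: C01_funP => x; rewrite -!C01_extE. Qed.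

(** The norm of [C] takes values in [K], whose order is only partial in the complex case; estimates
    are carried out on this real-valued version. *)
Definition nrm (f : C) : R := (\int[mu]_(t in `[0, 1]) real_norm (C01_ext f t))%R.

Lemma norm_nrm (f : C) : `|f| = of_real k (nrm f).
Proof. exact: C01_normE. Qed.

(** A 1-Lipschitz function of a continuous function is continuous, hence integrable on a compact
    interval. This covers [re] and [im] at once. *)
Lemma integrable_lipschitz (h : K -> R) (f : C) :
  (forall z w, `|h z - h w| <= real_norm (z - w)) ->
  mu.-integrable `[0, 1] (EFin \o (fun t => h (C01_ext f t))).
Proof.
move=> hL; apply: continuous_compact_integrable; first exact: segment_compact.
apply/subspace_sigL_continuousP.
have -> : sigL I01 (fun t => h (C01_ext f t)) = h \o C01_fun f.
  by apply/funext => x /=; rewrite -C01_extE.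
apply: (@continuous_comp_fun _ K^o); first exact: C01_cts.
move=> z; apply/(@cvgrPdist_lt _ _ _ (nbhs z) (@nbhs_filter K^o z)) => /= e e0.
have e0' : 0 < of_real k e.
  by rewrite -(of_real0 R k) ltr_of_real.
apply/nbhs_normP; exists (of_real k e) => //= w zw.
rewrite (le_lt_trans (hL _ _))//.
by rewrite -(@ltr_of_real R k) -normE.
Qed.

Lemma integrable_re (f : C) :
  mu.-integrable `[0, 1] (EFin \o (fun t => re (C01_ext f t))).
Proof.
apply: (@integrable_lipschitz (@re R k)) => z w; apply: le_trans (normr_re_le _).
by rewrite reD reN.
Qed.

Lemma integrable_im (f : C) :
  mu.-integrable `[0, 1] (EFin \o (fun t => im (C01_ext f t))).
Proof.
apply: (@integrable_lipschitz (@im R k)) => z w; apply: le_trans (normr_im_le _).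
by rewrite imD imN.
Qed.

Lemma integrable_nrm (f : C) :
  mu.-integrable `[0, 1] (EFin \o (fun t => real_norm (C01_ext f t))).
Proof. exact: integrable_real_norm_ext. Qed.

Lemma sub_half_itv : `[0, 1 / 2] `<=` I01.
Proof. move=> t; rewrite /= !in_itv/= => /andP[-> h] /=; lra. Qed.

Lemma integrable_half (h : R -> R) : mu.-integrable `[0, 1] (EFin \o h) ->
  mu.-integrable `[0, 1 / 2] (EFin \o h).
Proof. by apply: integrableS => //; exact: sub_half_itv. Qed.

(** Since [A] is its own intersection with [D], the left side is the integral over [D] of [h]
    patched by 0 off [A], which agrees with [h] on [D]. *)
Lemma Rintegral_supp (A D : set R) (h : R -> R) : A `<=` D ->
  (forall t, D t -> ~ A t -> h t = 0) ->
  (\int[mu]_(t in A) h t)%R = (\int[mu]_(t in D) h t)%R.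
Proof.
move=> AD h0; rewrite -(setIidr AD) Rintegral_mkcondr.
apply: eq_Rintegral => t /set_mem Dt; rewrite /patch.
by case: ifPn => //; rewrite notin_setE => /(h0 _ Dt).
Qed.

Lemma le_Rintegral_half (h : R -> R) :
  mu.-integrable `[0, 1] (EFin \o h) -> (forall t, 0 <= h t) ->
  (\int[mu]_(t in `[0, (1 / 2)]) h t <= \int[mu]_(t in `[0, 1]) h t)%R.
Proof.
move=> ih h0.
rewrite /Rintegral fine_le//.
- by apply: integrable_fin_num => //; exact: integrable_half.
- exact: integrable_fin_num.
apply: ge0_subset_integral => //.
- exact: (measurable_int _ ih).
- by move=> t _; rewrite lee_fin.
- exact: sub_half_itv.
Qed.

Lemma nrm_ge0 (f : C) : 0 <= nrm f.
Proof. by apply: Rintegral_ge0 => t _; exact: real_norm_ge0. Qed.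

Lemma nrm_eq0 (f : C) : nrm f = 0 -> f = 0.
Proof. by move=> f0; apply: normr0_eq0; rewrite norm_nrm f0 of_real0. Qed.

Lemma nrmN (f : C) : nrm (- f) = nrm f.
Proof. by apply: (@of_real_inj R k); rewrite -!norm_nrm normrN. Qed.

Lemma le_nrmD (f g : C) : nrm (f + g) <= nrm f + nrm g.
Proof. by rewrite -(@ler_of_real R k) of_realD -!norm_nrm ler_normD. Qed.

Lemma le_nrm (f g : C) :
  (forall t, real_norm (C01_ext f t) <= real_norm (C01_ext g t)) ->
  nrm f <= nrm g.
Proof.
move=> fg; apply: le_Rintegral => //; exact: integrable_nrm.
Qed.

Lemma nrmD_pointwise (f g : C) :
  (forall t, real_norm (C01_ext f t + C01_ext g t) =
             real_norm (C01_ext f t) + real_norm (C01_ext g t)) ->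
  nrm (f + g) = nrm f + nrm g.
Proof.
move=> fg; rewrite /nrm -RintegralD//; try exact: integrable_nrm.
by apply: eq_Rintegral => t _; rewrite C01_extD fg.
Qed.

(** The defect in the pointwise triangle inequality is continuous and nonnegative on [0,1] with
    integral 0, so it vanishes there. This turns orthogonality into a pointwise condition. *)
Lemma nrmD_eq_pointwise (f g : C) : nrm (f + g) = nrm f + nrm g ->
  forall t, real_norm (C01_ext (f + g) t) =
            real_norm (C01_ext f t) + real_norm (C01_ext g t).
Proof.
move=> fg t.
have [t01|t01] := boolP (t \in I01); last by rewrite !C01_ext_out// real_norm0 addr0.
pose h t := real_norm (C01_ext f t) + real_norm (C01_ext g t)
            - real_norm (C01_ext (f + g) t).
suff : h t = 0 by rewrite /h; lra.
have iD := @integrableD _ _ _ mu _ (measurable_itv _) _ _ (integrable_nrm f) (integrable_nrm g).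
apply: Rintegral_eq0 => //.
- move=> x; apply: cvgB; last exact: continuous_real_norm_ext.
  by apply: cvgD; exact: continuous_real_norm_ext.
- by move=> s; rewrite /h C01_extD subr_ge0; exact: ler_real_normD.
- rewrite RintegralB//; last exact: integrable_nrm.
  rewrite RintegralD//; try exact: integrable_nrm.
  by rewrite -!/(nrm _) fg subrr.
- exact: set_mem.
Qed.

Definition half_integral (f : C) : K^o := scalar_integral 0 (1 / 2) (C01_ext f).

Lemma half_integral_linear : linear half_integral.
Proof.
move=> c f g.
(* Scaling in [K^o] is multiplication in [K]; this form lets [reM] and [imM] apply, since the
   integral is defined by components. *)
change (half_integral (c *: f + g) = c * half_integral f + half_integral g :> K).
have ir h := integrable_half (integrable_re h).
have ii h := integrable_half (integrable_im h).
have mH : measurable (`[0, 1 / 2]%classic : set (measurableTypeR R)) := measurable_itv _.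
apply: scalar_ext.
- rewrite reD reM /half_integral !re_scalar_integral !im_scalar_integral.
  have i1 := integrableZl mH (re c) (ir f).
  have i2 := integrableZl mH (im c) (ii f).
  rewrite -(RintegralZl (re c) mH (ir f)) -(RintegralZl (im c) mH (ii f)).
  rewrite -(RintegralB mH i1 i2) -(RintegralD mH (integrableB mH i1 i2) (ir g)).
  by apply: eq_Rintegral => t _; rewrite C01_extD C01_extZ reD reM.
- rewrite imD imM /half_integral !re_scalar_integral !im_scalar_integral.
  have i1 := integrableZl mH (re c) (ii f).
  have i2 := integrableZl mH (im c) (ir f).
  rewrite -(RintegralZl (re c) mH (ii f)) -(RintegralZl (im c) mH (ir f)).
  rewrite -(RintegralD mH i1 i2) -(RintegralD mH (integrableD mH i1 i2) (ii g)).
  by apply: eq_Rintegral => t _; rewrite C01_extD C01_extZ imD imM.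
Qed.

HB.instance Definition _ :=
  GRing.isLinear.Build K C K^o _ half_integral half_integral_linear.

End C01Facts.

(** * Cutting a function off on one side of 1/2 *)

Section C01Cut.
Set Implicit Arguments.
Unset Strict Implicit.
Variables (R : realType) (k : scalar_kind).
Local Notation K := (scalars R k).
Local Notation C := (C01 R k).
Local Notation I01 := (`[0, 1]%classic : set R).
Local Notation mu := lebesgue_measure.

Lemma Rintegral0_eq (A : set R) (h : R -> R) :
  (forall t, A t -> h t = 0) -> (\int[mu]_(t in A) h t)%R = 0.
Proof.
by move=> h0; rewrite /Rintegral integral0_eq// => t /h0 ->.
Qed.

Lemma re_half_integral_le (f : C) : re (half_integral f) <= nrm f.
Proof.
rewrite re_scalar_integral; have inf := integrable_nrm f.
apply: (@le_trans _ _ (\int[mu]_(t in `[0%R, (1 / 2)%R]) real_norm (C01_ext f t))%R).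
  apply: le_Rintegral => //.
  - exact/integrable_half/integrable_re.
  - exact/integrable_half/inf.
  - by move=> t _; exact: le_trans (ler_norm _) (normr_re_le _).
by apply: le_Rintegral_half => // t; exact: real_norm_ge0.
Qed.

(* Rotate f by a unimodular scalar so that its integral becomes nonnegative. *)
Lemma norm_half_integral_le (f : C) : `|half_integral f : K^o| <= `|f|.
Proof.
have [->|z0] := eqVneq (half_integral f) 0; first by rewrite normr0.
pose c : K := `|half_integral f| / half_integral f.
have c1 : `|c| = 1 by rewrite normrM normfV normr_id divff// normr_eq0.
have cf : half_integral (c *: f) = `|half_integral f| :> K.
  by rewrite linearZ /=; exact: divfK.
have -> : `|f| = `|c *: f| by rewrite normrZ c1 mul1r.
rewrite norm_nrm normE ler_of_real.
by apply: le_trans (re_half_integral_le _); rewrite cf normE re_of_real.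
Qed.

Lemma half_integral_continuous : continuous (@half_integral R k).
Proof.
apply: bounded_linear_continuous; apply/bounded_funP => r; exists r => f.
exact/le_trans/norm_half_integral_le.
Qed.

Lemma cut_cts (s : R) (f : C) : continuous
  (fun x : I01 => (of_real k (ramp (s * (val x - 1 / 2))) : K^o) * C01_fun f x : K^o).
Proof.
have cv : continuous (fun x : I01 => val x) by exact: initial_continuous.
have aff : continuous (fun y : R => s * (y - 1 / 2)).
  by move=> y; apply: cvgMr; apply: cvgB; [exact: cvg_id|exact: cvg_cst].
have c1 := continuous_comp_fun cv aff.
have c2 := continuous_comp_fun c1 (@continuous_ramp R).
have c3 := continuous_comp_fun c2 (@continuous_of_real R k).
by move=> x; exact: (cvgM (c3 x) (@C01_cts R k f x)).
Qed.

(** A continuous substitute for restriction to a half interval: the factor is supported to the right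
    of 1/2 if [s > 0] and to the left if [s < 0], and reaches 1 at distance 1/|s| from 1/2. *)
Definition cut (s : R) (f : C) : C := mkC01 (@cut_cts s f).

Lemma C01_ext_cut s f t :
  C01_ext (cut s f) t = of_real k (ramp (s * (t - 1 / 2))) * C01_ext f t.
Proof.
have [t01|t01] := boolP (t \in I01); last by rewrite !C01_ext_out// mulr0.
by rewrite !(C01_ext_in _ t01).
Qed.

Lemma cutD s f g : cut s (f + g) = cut s f + cut s g.
Proof. by apply: C01_ext_inj => t; rewrite !(C01_extD, C01_ext_cut) mulrDr. Qed.

Lemma cutZ s (c : K) f : cut s (c *: f) = c *: cut s f.
Proof. by apply: C01_ext_inj => t; rewrite !(C01_extZ, C01_ext_cut) mulrCA. Qed.

Lemma cut0 s : cut s 0 = 0.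
Proof. by rewrite -(scale0r (0 : C)) cutZ !scale0r. Qed.

(** The cutoff factor lies in [0,1]. Contractivity is what makes the kernel of [cut s] closed. *)
Lemma nrm_cut_le s f : nrm (cut s f) <= nrm f.
Proof.
apply: le_nrm => t; rewrite C01_ext_cut real_normM real_norm_of_real.
by rewrite ger0_norm ?ramp_ge0// ler_piMl ?real_norm_ge0 ?ramp_le1.
Qed.

(** The ramp factor is nonzero at such [t] and cancels. Thus [cut 1 f = 0] expresses, as a linear
    and closed condition, that [f] vanishes to the right of 1/2. *)
Lemma cut_eq0 s f t : cut s f = 0 -> 0 < s * (t - 1 / 2) -> C01_ext f t = 0.
Proof.
move=> /(congr1 (fun h => C01_ext h t)); rewrite C01_ext_cut C01_ext0 => /eqP.
rewrite mulf_eq0 => /orP[|/eqP//].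
by rewrite -(of_real0 R k) (inj_eq (@of_real_inj _ _)) => + /ramp_gt0 h; rewrite gt_eqF.
Qed.

Lemma C01_ext_cut_eq0 s f t : s * (t - 1 / 2) <= 0 -> C01_ext (cut s f) t = 0.
Proof. by move=> h; rewrite C01_ext_cut ramp_eq0// of_real0 mul0r. Qed.

(** The two pieces are [f] times nonnegative weights with sum 1, so the modulus of [f] splits
    pointwise. *)
Lemma nrm_cut_split s f : nrm f = nrm (f - cut s f) + nrm (cut s f).
Proof.
rewrite -nrmD_pointwise ?subrK// => t.
rewrite !(C01_extD, C01_extN, C01_ext_cut) subrK -mulNr -{2}[C01_ext f t]mul1r.
rewrite -mulrDl -of_real1 -of_realN -of_realD !real_normM !real_norm_of_real.
rewrite !ger0_norm ?ramp_ge0 ?subr_ge0 ?ramp_le1// -mulrDl subrK mul1r//.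
Qed.

Definition one : C := mkC01 (@C01_cst_cts R k 1).

Lemma C01_ext_one t : t \in I01 -> C01_ext one t = 1.
Proof. by move=> t01; rewrite (C01_ext_in _ t01). Qed.

Lemma C01_ext_cut_one s t : t \in I01 ->
  C01_ext (cut s one) t = of_real k (ramp (s * (t - 1 / 2))).
Proof. by move=> t01; rewrite C01_ext_cut C01_ext_one// mulr1. Qed.

(** The function is nonnegative and vanishes to the right of 1/2, so its half integral is its whole
    L_1 norm. *)
Lemma half_integral_cut_one s : s <= 0 ->
  half_integral (cut s one) = `|cut s one| :> K.
Proof.
move=> s0; rewrite norm_nrm; apply: scalar_ext.
- rewrite re_of_real re_scalar_integral /nrm -(@Rintegral_supp _ `[0, 1 / 2] I01).
  + apply: eq_Rintegral => t /set_mem/sub_half_itv/mem_set t01.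
    by rewrite C01_ext_cut_one// re_of_real real_norm_of_real ger0_norm ?ramp_ge0.
  + exact: sub_half_itv.
  + move=> t /=; rewrite !in_itv/= => /andP[-> _] /= /negP; rewrite -ltNge => t2.
    rewrite C01_ext_cut_eq0 ?real_norm0//.
    by rewrite mulr_le0_ge0// subr_ge0 ltW.
- rewrite im_of_real im_scalar_integral Rintegral0_eq// => t.
  move=> /sub_half_itv/mem_set t01.
  by rewrite C01_ext_cut_one// im_of_real.
Qed.

Lemma half_integral_cut_eq0 s f : 0 <= s -> half_integral (cut s f) = 0 :> K.
Proof.
move=> s0; have z t : `[0, 1 / 2]%classic t -> C01_ext (cut s f) t = 0.
  rewrite /= in_itv/= => /andP[_ t2]; rewrite C01_ext_cut_eq0//.
  by rewrite mulr_ge0_le0// subr_le0.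
apply: scalar_ext.
- rewrite re_scalar_integral -(of_real0 R k) re_of_real Rintegral0_eq// => t.
  by move=> /z ->; rewrite -(of_real0 R k) re_of_real.
- rewrite im_scalar_integral -(of_real0 R k) im_of_real Rintegral0_eq// => t.
  by move=> /z ->; rewrite -(of_real0 R k) im_of_real.
Qed.

Lemma cut_one_neq0 s : s < 0 -> cut s one != 0.
Proof.
(* The function is tested at 0, the left end of the interval, where the argument of the ramp is
   [- s / 2 > 0]. *)
move=> s0; apply/eqP => /(@cut_eq0 s one 0); rewrite C01_ext_one; last first.
  by rewrite inE/= in_itv/= lexx ler01.
move=> H; have /H/eqP : 0 < s * (0 - 1 / 2) by rewrite nmulr_rgt0//; lra.
by rewrite oner_eq0.
Qed.

(** Ramps of slope 1/d reach 1 at distance [d] from 1/2, so the error is supported in a window of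
    length 2d, inside [0,1] because [d <= 1 / 2], and has modulus at most 1. *)
Lemma nrm_one_sub_cut_le d : 0 < d -> d <= 1 / 2 ->
  nrm (one - (cut (- d^-1) one + cut d^-1 one)) <= d *+ 2.
Proof.
move=> d0 d2; have di : 0 < d^-1 by rewrite invr_gt0.
set h := one - _.
have hE t : t \in I01 -> C01_ext h t =
    of_real k (1 - ramp (- d^-1 * (t - 1 / 2)) - ramp (d^-1 * (t - 1 / 2))).
  move=> t01; rewrite /h C01_extD C01_extN C01_extD !C01_ext_cut_one// C01_ext_one//.
  by rewrite !(of_realD, of_realN) of_real1 opprD addrA.
have sJ : `[1 / 2 - d, 1 / 2 + d] `<=` I01.
  by move=> t; rewrite /= !in_itv/= => /andP[? ?]; apply/andP; split; lra.
rewrite /nrm -(@Rintegral_supp _ `[1 / 2 - d, 1 / 2 + d] I01)//; last first.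
  move=> t /mem_set t01 tJ; rewrite hE// real_norm_of_real.
  (* Outside the window exactly one ramp equals 1 and the other is 0: the right one for
     [t >= 1 / 2], the left one otherwise. *)
  have [t2|t2] := leP (1 / 2) t.
    rewrite ramp_eq0 ?ramp_eq1 ?subr0 ?subrr ?normr0//.
    - rewrite mulrC ler_pdivlMr// mul1r leNgt; apply/negP => td.
      apply: tJ; rewrite /= in_itv/=; apply/andP; split; lra.
    - by rewrite mulNr oppr_le0 mulr_ge0 ?subr_ge0// ltW.
  rewrite ramp_eq1 ?ramp_eq0 ?subr0 ?subrr ?normr0//.
  - by rewrite pmulr_rle0// subr_le0 ltW.
  - rewrite mulNr -mulrN mulrC ler_pdivlMr// mul1r leNgt; apply/negP => td.
    apply: tJ; rewrite /= in_itv/=; apply/andP; split; lra.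
have -> : d *+ 2 = (\int[mu]_(t in `[(1 / 2 - d)%R, (1 / 2 + d)%R]) 1)%R.
  rewrite Rintegral_cst//=  lebesgue_measure_itv/= lte_fin ifT/=; last lra.
  rewrite mul1r mulr2n; lra.
apply: le_Rintegral => //.
- by have := integrable_nrm h; apply: integrableS.
- apply: continuous_compact_integrable; first exact: segment_compact.
  by apply: continuous_subspaceT => x; exact: cst_continuous.
move=> t /sJ/mem_set t01; rewrite hE// real_norm_of_real.
have r1 := ramp_ge0 (- d^-1 * (t - 1 / 2)); have r1' := ramp_le1 (- d^-1 * (t - 1 / 2)).
have r2 := ramp_ge0 (d^-1 * (t - 1 / 2)); have r2' := ramp_le1 (d^-1 * (t - 1 / 2)).
by rewrite ler_norml; apply/andP; split; lra.
Qed.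

(** The points strictly on the side of 1/2 given by the sign of [s] accumulate at 1/2, so continuity
    carries the zero over. *)
Lemma C01_ext_half_eq0 s (f : C) : s != 0 ->
  (forall t, t \in I01 -> 0 < s * (t - 1 / 2) -> C01_ext f t = 0) ->
  C01_ext f (1 / 2) = 0.
Proof.
move=> s0 fs; apply: contrapT => /eqP fh.
have h01 : I01 (1 / 2) by rewrite /= in_itv/=; apply/andP; split; lra.
have g0 : 0 < real_norm (C01_ext f (1 / 2)).
  by rewrite lt_neqAle real_norm_ge0 andbT eq_sym; apply: contra_neq fh => /real_norm_eq0.
have /subspace_continuousP/(_ _ h01)/cvgrPdist_lt/(_ _ g0) := @continuous_real_norm_ext R k f.
rewrite near_withinE => /nbhs_ballP[e /= e0 He].
(* A displacement of [e / 2] stays in the continuity neighbourhood, and one of 1/2 stays in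
   [0,1]. *)
pose m := Num.min (e / 2) (1 / 2).
have m0 : 0 < m by rewrite /m lt_min; apply/andP; split; lra.
have [me m2] : m <= e / 2 /\ m <= 1 / 2 by rewrite /m !ge_min !lexx orbT.
pose t := 1 / 2 + Num.sg s * m.
have sm : `|Num.sg s * m| = m by rewrite normrM normr_sg s0 mul1r gtr0_norm.
have : - m <= Num.sg s * m <= m by rewrite -ler_norml sm.
move=> /andP[sm1 sm2].
have t01 : I01 t by rewrite /= in_itv/= /t; apply/andP; split; lra.
have ft : C01_ext f t = 0.
  apply: fs; first exact: mem_set.
  by rewrite /t addrAC subrr add0r mulrA [s * _]mulrC -normrEsg mulr_gt0// normr_gt0.
have te : `|1 / 2 - t| < e by rewrite /t opprD addrA subrr sub0r normrN sm; lra.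
have := He t te t01.
by rewrite /= /from_subspace ft real_norm0 subr0 ger0_norm ?real_norm_ge0// ltxx.
Qed.

End C01Cut.

(** * The face exposed by the half integral, and its failure of symmetry *)

Section FirstHalfFace.
Set Implicit Arguments.
Unset Strict Implicit.
Variables (R : realType) (k : scalar_kind).
Local Notation K := (scalars R k).
Local Notation C := (C01 R k).
Local Notation I01 := (`[0, 1]%classic : set R).
Local Notation one := (@one R k).
Local Notation F := (face (@half_integral R k) : set C).

Lemma unit_ball_nrm (f : C) : unit_ball f <-> nrm f <= 1.
Proof. by rewrite /unit_ball /= norm_nrm -(of_real1 R k) ler_of_real. Qed.

(* With r = cut 1 f, both 1 = |half_integral (f - r)| <= ||f - r|| and
   ||f|| = ||f - r|| + ||r||, so r = 0. *)
Lemma face_cut_eq0 f : F f -> cut 1 f = 0.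
Proof.
move=> [/unit_ball_nrm f1 uf]; apply: nrm_eq0; apply/eqP.
rewrite eq_le nrm_ge0 andbT.
have := re_half_integral_le (f - cut 1 f).
rewrite linearB /= half_integral_cut_eq0// subr0 uf -(of_real1 R k) re_of_real.
have := nrm_cut_split 1 f; lra.
Qed.

Lemma linear_span_cut_eq0 f : linear_span F f -> cut 1 f = 0.
Proof.
move=> [n [a [s [Fs ->]]]].
elim/big_ind: _ => [|g h g0 h0|i _]; first exact: cut0.
- by rewrite cutD g0 h0 addr0.
- by rewrite cutZ face_cut_eq0// scaler0.
Qed.

(** If [g] in the span is closer to [f] than the norm of [cut 1 f], then [cut 1 (f - g) = cut 1 f]
    contradicts contractivity. *)
Lemma closure_span_cut_eq0 f : closure (linear_span F) f -> cut 1 f = 0.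
Proof.
move=> cf; apply: nrm_eq0; apply/eqP; rewrite eq_le nrm_ge0 andbT.
rewrite leNgt; apply/negP => e0.
have e0' : 0 < of_real k (nrm (cut 1 f)) by rewrite -(of_real0 R k) ltr_of_real.
have [g [/linear_span_cut_eq0 g0]] := cf _ (nbhsx_ballx f _ e0').
rewrite -ball_normE /= norm_nrm ltr_of_real; apply/negP; rewrite -leNgt.
apply: le_trans (nrm_cut_le 1 _).
by rewrite cutD -scaleN1r cutZ g0 scaler0 addr0.
Qed.

(** Left ramps attain the norm of the functional, so normalizing them gives explicit face elements.
    They show that the face is nonempty, put left ramps in its span and serve as test functions for
    orthogonality. *)
Lemma face_normalized_cut s : s < 0 ->
  F (`|cut s one|^-1 *: cut s one).
Proof.
move=> s0; have p0 := cut_one_neq0 k s0; split.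
  by rewrite /unit_ball /= normrZ normfV normr_id mulVf// normr_eq0.
rewrite linearZ /= half_integral_cut_one ?ltW//.
by apply: mulVf; rewrite normr_eq0.
Qed.

Lemma half_face_norm_exposed : norm_exposed_face F.
Proof.
have F1 := face_normalized_cut (@ltrN10 R).
split; first by eexists; exact: F1.
exists (@half_integral R k); split => //; first exact: half_integral_continuous.
split.
- move=> _ [f f1 <-]; exact: le_trans (norm_half_integral_le f) f1.
(* Any upper bound dominates the value 1 attained at a face element. *)
- move=> c; apply; have [b1 u1] := F1.
  by eexists; first exact: b1; rewrite u1 normr1.
Qed.

Lemma cut_one_span s : s < 0 -> linear_span F (cut s one).
Proof.
move=> s0; exists 1%N, (fun=> `|cut s one|), (fun=> `|cut s one|^-1 *: cut s one).
split=> [_|]; first exact: face_normalized_cut.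
by rewrite big_ord1 scalerA divff ?scale1r// normr_eq0 cut_one_neq0.
Qed.

(** Face elements vanish to the right of 1/2 and this ramp to the left; norms of functions with
    disjoint supports add. *)
Lemma cut_one_orthocompl s : 0 < s -> orthocompl F (cut s one).
Proof.
move=> s0 g Fg.
have z t : C01_ext (cut s one) t = 0 \/ C01_ext g t = 0.
  have [t2|t2] := leP t (1 / 2).
    by left; rewrite C01_ext_cut_eq0// pmulr_rle0// subr_le0.
  by right; apply: (cut_eq0 (face_cut_eq0 Fg)); rewrite mul1r subr_gt0.
(* Stated for a general [h] so as to serve for both [g] and [- g]. *)
have H (h : C) : nrm h = nrm g -> (forall t, C01_ext g t = 0 -> C01_ext h t = 0) ->
    `|cut s one + h| = `|cut s one| + `|g|.
  move=> hg h0; rewrite !norm_nrm -of_realD -hg nrmD_pointwise// => t.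
  by case: (z t) => [->|/h0 ->]; rewrite ?addr0 ?add0r real_norm0 ?addr0 ?add0r.
split; first exact: H.
by apply: H; [exact: nrmN|move=> t gt; rewrite C01_extN gt oppr0].
Qed.

(** If [g] is fixed, then [T one - one = T (one - g) - (one - g)] has norm at most twice that of
    [one - g], which is arbitrarily small for sums of two ramps. *)
Lemma isometry_fix_one (T : {linear C -> C}) :
  (forall f, `|T f| = `|f|) ->
  (forall f g, linear_span F f -> orthocompl F g -> T (f + g) = f + g) ->
  T one = one.
Proof.
move=> isoT fixT.
have nT f : nrm (T f) = nrm f.
  by apply: (@of_real_inj R k); rewrite -!norm_nrm isoT.
apply/eqP; rewrite -subr_eq0; apply/eqP/nrm_eq0/eqP.
rewrite eq_le nrm_ge0 andbT; apply/ler_addgt0Pr => e e0; rewrite add0r.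
(* The distance from [one] to [g] is at most 2d and gets doubled, whence [e / 4]; the bound 1/2
   keeps the window inside [0,1]. *)
pose d := Num.min (e / 4) (1 / 2).
have d0 : 0 < d by rewrite /d lt_min; apply/andP; split; lra.
have [d1 d2] : d <= e / 4 /\ d <= 1 / 2 by rewrite /d !ge_min !lexx orbT.
have := nrm_one_sub_cut_le k d0 d2; set g := cut _ _ + _ => dg.
have Tg : T g = g.
  apply: fixT.
  - by apply: cut_one_span; rewrite oppr_lt0 invr_gt0.
  - by apply: cut_one_orthocompl; rewrite invr_gt0.
have -> : T one - one = T (one - g) - (one - g).
  by rewrite linearB /= Tg opprB addrA subrK.
apply: le_trans (le_nrmD _ _) _; rewrite nrmN nT.
rewrite mulr2n in dg; lra.
Qed.

Lemma half_face_not_symmetric : ~ symmetric_face F.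
Proof.
move=> [T [isoT _ _ [fixE _]]].
have T1 : T one = one.
  apply: isometry_fix_one => // f g Ff Fg.
  suff : [set x | T x = x] (f + g) by [].
  rewrite fixE; exists f; first exact: subset_closure.
  by exists g.
have : [set x | T x = x] one by [].
rewrite fixE => -[a /closure_span_cut_eq0 a0 [b bF ab]].
have h01 : (1 / 2 : R) \in I01.
  by rewrite inE /= in_itv/=; apply/andP; split; lra.
have ah : C01_ext a (1 / 2) = 0.
  apply: (@C01_ext_half_eq0 _ _ 1) => [|t _ t2]; first exact: oner_neq0.
  exact: cut_eq0 a0 t2.
have bh : C01_ext b (1 / 2) = 0.
  apply: (@C01_ext_half_eq0 _ _ (- 1)) => [|t t01 t2].
    by rewrite oppr_eq0 oner_neq0.
  (* The test element [p] is a positive real at each [t < 1 / 2]. Additivity of the norm for both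
     [b + p] and [b - p] passes to pointwise moduli, and the parallelogram law then gives [b = 0]
     there. *)
  have [] := bF _ (face_normalized_cut (@ltrN10 R)).
  set p := _ *: _; rewrite !norm_nrm -!of_realD => /of_real_inj + /of_real_inj.
  (* The equality for [b - p] is put in the form of a sum with [- p], as the pointwise criterion
     requires. *)
  rewrite -(nrmN p) => pD; rewrite (nrmN p) in pD => pB.
  have pt : exists2 x, 0 < x & C01_ext p t = of_real k x.
    exists ((nrm (cut (- 1) one))^-1 * ramp (- 1 * (t - 1 / 2))).
      rewrite mulr_gt0 ?ramp_gt0// invr_gt0 lt_neqAle nrm_ge0 andbT eq_sym.
      apply/eqP => /nrm_eq0/eqP; apply/negP/cut_one_neq0; exact: ltrN10.
    rewrite /p C01_extZ C01_ext_cut_one// of_realM; congr (_ * _).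
    by rewrite norm_nrm of_realV.
  have [x x0 px] := pt.
  have := nrmD_eq_pointwise pD t; have := nrmD_eq_pointwise pB t.
  rewrite !C01_extD !C01_extN px real_normN real_norm_of_real gtr0_norm//.
  by move=> hB hD; exact: real_norm_add_sub_eq0 x0 hD hB.
(* Evaluating [one = a + b] at 1/2 gives 1 = 0 + 0. *)
have := C01_extD a b (1 / 2).
rewrite ab ah bh addr0 C01_ext_one// => /eqP; rewrite oner_eq0//.
Qed.

End FirstHalfFace.

Theorem proposition4p9 (R : realType) (k : scalar_kind) :
  let F : set (C01 R k) :=
    [set f | unit_ball f /\ scalar_integral 0 (1 / 2) (C01_ext f) = 1] in
  ~ weakly_facially_symmetric (C01 R k) /\
  norm_exposed_face F /\ ~ symmetric_face F.
Proof.
(* By unfolding, [F] is the face of the linear functional [half_integral]. *)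
move=> F; have Fexp : norm_exposed_face F := @half_face_norm_exposed R k.
have Fsym : ~ symmetric_face F := @half_face_not_symmetric R k.
by split=> // wfs; exact/Fsym/wfs.
Qed.
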